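(* Let $\rho=a+b-(\sup(p_0)-\inf(p_0))$, where $\sup(p_0)=\max(p_0(1),p_0(2))$ and $\inf(p_0)=\min(p_0(1),p_0(2))$. If $\rho\le0$ then there exists $c>0$ (not depending on $N$) such that $$\forall N\ge2,\quad\lambda_N>c.$$
   Context: Let $a,b>0$ and $p_0(1),p_0(2)\ge0$ with $p_0(1)+p_0(2)>0$. For an integer $N\ge2$, consider the birth and death process on $\{0,\dots,N\}$ with generator $$\mathcal{G}f(n)=b_n(f(n+1)-f(n))+d_n(f(n-1)-f(n)),$$ where $$b_n=(N-n)\Big(b+p_0(2)\frac{n}{N-1}\Big),\qquad d_n=n\Big(a+p_0(1)\frac{N-n}{N-1}\Big).$$ (This is the process of the number of particles at site $1$ in the $N$-particle Fleming-Viot system on two sites $\{1,2\}$ with jump rates $a$ from $1$ to $2$, $b$ from $2$ to $1$, and death rates $p_0(1),p_0(2)$.) It is reversible with respect to its unique invariant distribution; $\lambda_N$ denotes its spectral gap, i.e. the smallest positive eigenvalue of $-\mathcal{G}$. *)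

(* Defs.v *)
From HB Require Import structures.
From mathcomp Require Import all_boot all_order all_algebra.
From mathcomp Require Import classical_sets reals ring.

Set Implicit Arguments.
Unset Strict Implicit.
Unset Printing Implicit Defensive.
Import Order.TTheory GRing.Theory Num.Theory.
Local Open Scope ring_scope.

Definition birth_rate (R : realType) (b p2 : R) (N n : nat) : R :=
  (N%:R - n%:R) * (b + p2 * (n%:R / (N%:R - 1))).

Definition death_rate (R : realType) (a p1 : R) (N n : nat) : R :=
  n%:R * (a + p1 * ((N%:R - n%:R) / (N%:R - 1))).

(* Functions {0, ..., N} -> R; [R^o] provides the vector space structure. *)
Notation state_fun R N := {ffun 'I_N.+1 -> R^o}.

(* The arbitrary values taken by [inord n.+1] at n = N and by [inord n.-1] at
   n = 0 are harmless: birth_rate N N = 0 and death_rate N 0 = 0. *)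
Definition generator (R : realType) (a b p1 p2 : R) (N : nat)
    (f : state_fun R N) : state_fun R N :=
  [ffun n : 'I_N.+1 =>
     birth_rate b p2 N n * (f (inord n.+1) - f n)
   + death_rate a p1 N n * (f (inord n.-1) - f n)].

Section Linearity.
Variables (R : realType) (a b p1 p2 : R) (N : nat).

Fact generator_is_linear : linear (@generator R a b p1 p2 N).
Proof.
have lin (c B D x x' y y' z z' : R) :
    B * (c * x + x' - (c * y + y')) + D * (c * z + z' - (c * y + y'))
  = c * (B * (x - y) + D * (z - y)) + (B * (x' - y') + D * (z' - y')) by ring.
by move=> c f g; apply/ffunP => n; rewrite !ffunE; exact: lin.
Qed.

HB.instance Definition _ :=
  GRing.isLinear.Build R (state_fun R N) (state_fun R N) _
    (@generator R a b p1 p2 N) generator_is_linear.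

End Linearity.

Definition smallest_positive_eigenvalue (R : realType) (vT : vectType R)
    (L : 'End(vT)) (l : R) : Prop :=
  [/\ passmx.leigenvalue L l, 0 < l
    & forall m, passmx.leigenvalue L m -> 0 < m -> l <= m].

(* Default value 0 if there is no positive eigenvalue; hence a bound
   [c < spectral_gap ...] with [0 < c] also asserts that the gap exists. *)
Definition spectral_gap (R : realType) (a b p1 p2 : R) (N : nat) : R :=
  xget 0 [set l | smallest_positive_eigenvalue
                    (- linfun (@generator R a b p1 p2 N)) l]%classic.

Lemma spectral_gap_eq (R : realType) (a b p1 p2 : R) (N : nat) (l : R) :
  smallest_positive_eigenvalue (- linfun (@generator R a b p1 p2 N)) l ->
  spectral_gap a b p1 p2 N = l.
Proof.
move=> lP; apply: xget_unique => // m [em m0 mmin].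
by case: lP => el l0 lmin; apply/le_anti; rewrite mmin // lmin.
Qed.

(* Main.v *)
(* If f is an eigenfunction of -G for l, its gradient g(n) = f(n+1) - f(n)
   satisfies l g(n) = (b_n + d_(n+1)) g(n) - b_(n+1) g(n+1) - d_n g(n-1).
   Evaluating this where |g|/w is maximal shows, for every positive weight w,
   l >= min_n (b_n + d_(n+1) - b_(n+1) w(n+1)/w(n) - d_n w(n-1)/w(n)).
   When p1 >= p2, the weight w(n) = 1/(N - n) turns the expression to be
   minimized into at least (a - p1/(N-1)) (N+1)/(N-n+1) + (p1-p2) (N-n)/(N-1),
   which is at least a/2 once N - 1 >= 2 p1 / a; the case p1 <= p2 is its mirror
   image under n -> N - n.  The finitely many remaining N only need a positive
   gap, whose existence comes from a Sturm sequence: gradients are eigenvectors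
   of a tridiagonal matrix, and the first roots of the characteristic
   polynomials of its leading minors decrease and stay positive. *)
Require Import Defs.
From mathcomp Require Import all_boot all_order all_algebra.
From mathcomp Require Import reals.
From mathcomp Require Import polyrcf ring lra.
Set Implicit Arguments.
Unset Strict Implicit.
Unset Printing Implicit Defensive.
Import Order.TTheory GRing.Theory Num.Theory.
Local Open Scope ring_scope.

(** [next_rootP] yields the first root after [x]; a nonpositive value before it would create an
    earlier root by the intermediate value theorem. *)
Lemma poly_first_root (R : rcfType) (p : {poly R}) (x y : R) :
  x <= y -> 0 < p.[x] -> p.[y] < 0 ->
  exists r, [/\ x < r < y, p.[r] = 0
               & forall z, x <= z -> z < r -> 0 < p.[z]].
Proof.
move=> le_xy px py.
have [r0 r0xy rpr0] : {r | r \in `]x, y[ & root p r}.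
  by apply: poly_ivtoo => //; rewrite pmulr_rlt0.
case: (next_rootP p x y) => [p0 | r _ pr rxy noroot | c _ _ noroot].
- by move: px; rewrite p0 horner0 ltxx.
- exists r; split => // z xz zr; rewrite ltNge; apply/negP => pz.
  have [t txz rpt] : {t | t \in `[x, z] & root p t}.
    by apply: polyrcf.poly_ivt => //; rewrite pmulr_rle0.
  have : t \in `]x, r[.
    move: txz; rewrite !in_itv /= => /andP[xt tz].
    rewrite (le_lt_trans tz zr) andbT lt_neqAle xt andbT.
    by apply: contraTneq rpt => <-; rewrite rootE gt_eqF.
  by move=> /noroot; rewrite rpt.
- by move: (noroot _ r0xy); rewrite rpr0.
Qed.

(** * Birth and death chains and the gradients of their eigenfunctions *)

Section BirthDeath.
Variables (R : realType) (b d : nat -> R) (N : nat).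

Definition bd_eigenfunction (l : R) (f : nat -> R) :=
  forall n, (n <= N)%N ->
    b n * (f n.+1 - f n) + d n * (f n.-1 - f n) = - l * f n.

(** Solved for the last term, so that it reads as a forward recursion. When [d 0 = 0] and [b N = 0],
    only [g 0], ..., [g N.-1] matter: at [n = N.-1] the left-hand side is 0, which is the boundary
    condition. *)
Definition gradient_eigenfunction (l : R) (g : nat -> R) :=
  forall n, (n < N)%N ->
    b n.+1 * g n.+1 = (b n + d n.+1 - l) * g n - d n * g n.-1.

Hypotheses (d0 : d 0 = 0) (bN : b N = 0).
Hypothesis b_gt0 : forall n, (n < N)%N -> 0 < b n.
Hypothesis d_gt0 : forall n, (0 < n <= N)%N -> 0 < d n.

Lemma gradient_of_eigenfunction l f :
  bd_eigenfunction l f -> gradient_eigenfunction l (fun n => f n.+1 - f n).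
Proof.
move=> fP n nN; have := fP n (ltnW nN); have := fP n.+1 nN.
case: n nN => [|n] nN /= e1 e0; rewrite ?d0 in e1 e0 *; nra.
Qed.

(** This function is minus the generator applied to a primitive of [g]. Its gradient is [l * g]
    below [N]; at [n = N] that identity is replaced by [b N = 0]. *)
Lemma eigenfunction_of_gradient l g :
  gradient_eigenfunction l g ->
  bd_eigenfunction l (fun n => d n * g n.-1 - b n * g n).
Proof.
move=> gP n nN.
have D k : (k < N)%N ->
    d k.+1 * g k - b k.+1 * g k.+1 - (d k * g k.-1 - b k * g k) = l * g k.
  by move=> /gP ->; ring.
have bt : b n * (d n.+1 * g n - b n.+1 * g n.+1 - (d n * g n.-1 - b n * g n))
        = b n * (l * g n).
  move: nN; rewrite leq_eqVlt => /predU1P[->|/D -> //].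
  by rewrite bN !mul0r.
rewrite /= bt; case: n nN {bt} => [|n] nN; first by rewrite d0; ring.
by rewrite -[_.+1.-1]/n -opprB D //; ring.
Qed.

(** Gershgorin's bound for the gradient matrix conjugated by the diagonal matrix of [w]; the
    condition is multiplied by [w n] to avoid quotients. *)
Lemma gradient_eigenvalue_ge (l c : R) (g w : nat -> R) :
  gradient_eigenfunction l g ->
  (exists2 n, (n < N)%N & g n != 0) ->
  (forall n, (n < N)%N -> 0 < w n) ->
  (forall n, (n < N)%N ->
     b n.+1 * w n.+1 + d n * w n.-1 + c * w n <= (b n + d n.+1) * w n) ->
  c <= l.
Proof.
move=> gP [n0 n0N gn0] w_gt0 wP.
have [i _ imax] := @Order.TotalTheory.arg_maxP _ _ _ (Ordinal n0N) xpredT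
  (fun j : 'I_N => `|g j| / w j) isT.
set M := `|g i| / w i in imax.
have wi := w_gt0 i (ltn_ord i).
have gi : `|g i| = M * w i by rewrite /M divfK // gt_eqF.
have gM j : (j < N)%N -> `|g j| <= M * w j.
  by move=> jN; rewrite -ler_pdivrMr ?w_gt0 //; exact: (imax (Ordinal jN)).
have M_gt0 : 0 < M.
  have := gM _ n0N; rewrite -(pmulr_lgt0 _ (w_gt0 _ n0N)).
  by apply: lt_le_trans; rewrite normr_gt0.
(* A neighbour of [i] outside the range of the maximum has coefficient [d 0 = 0] here, and [b N = 0]
   in [bM]. *)
have dM : `|d i * g i.-1| <= M * (d i * w i.-1).
  have iN := ltn_ord i; case: (nat_of_ord i) iN => [|k] kN.
    by rewrite d0 !mul0r normr0 mulr0.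
  have dk : 0 < d k.+1 by rewrite d_gt0 //= ltnW.
  by rewrite normrM gtr0_norm // mulrCA ler_pM2l // gM // ltnW.
have bM : `|b i.+1 * g i.+1| <= M * (b i.+1 * w i.+1).
  have := ltn_ord i; rewrite leq_eqVlt => /predU1P[->|iN].
    by rewrite bN !mul0r normr0 mulr0.
  have bk := b_gt0 iN.
  by rewrite normrM gtr0_norm // mulrCA ler_pM2l // gM.
have e : (b i + d i.+1 - l) * g i = b i.+1 * g i.+1 + d i * g i.-1.
  by rewrite gP //; ring.
have le1 : (b i + d i.+1 - l) * `|g i|
        <= M * (b i.+1 * w i.+1) + M * (d i * w i.-1).
  apply: le_trans (lerD bM dM); apply: le_trans (ler_normD _ _).
  by rewrite -e normrM ler_wpM2r // ler_norm.
rewrite gi in le1.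
have := wP i (ltn_ord i); rewrite -(ler_pM2l M_gt0) => le2.
have Mw : 0 < M * w i by exact: mulr_gt0.
by rewrite -(ler_pM2r Mw); clearbody M; nra.
Qed.

(** * Sturm sequence of the gradient matrix *)

(* Characteristic polynomials of the leading minors of minus the tridiagonal
   matrix acting on gradients; at n = 0 the junk factor Q 0.-1 has coefficient
   d 0 = 0. *)
Fixpoint sturm_poly n : {poly R} :=
  if n is m.+1 then
    ((b m + d m.+1)%:P - 'X) * sturm_poly m - (b m * d m) *: sturm_poly m.-1
  else 1.

Lemma horner_sturm_poly n x :
  (sturm_poly n.+1).[x] = (b n + d n.+1 - x) * (sturm_poly n).[x]
                          - b n * d n * (sturm_poly n.-1).[x].
Proof. by rewrite /= !hornerE. Qed.

(** At 0 the second-order recurrence reduces to the first-order one [rec], whose terms are all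
    positive. *)
Lemma sturm_poly_gt0 n : (n <= N)%N -> 0 < (sturm_poly n).[0].
Proof.
have rec m : (sturm_poly m.+1).[0]
    = d m.+1 * (sturm_poly m).[0] + \prod_(i < m.+1) b i.
  elim: m => [|m IH].
    by rewrite horner_sturm_poly /= big_ord1 d0 !hornerE; ring.
  rewrite horner_sturm_poly big_ord_recr /=.
  by rewrite -/(sturm_poly m.+1) IH; ring.
elim: n => [_|n IH nN]; first by rewrite /= hornerE.
rewrite rec addr_gt0 ?mulr_gt0 ?IH ?d_gt0 ?(ltnW nN) //.
by apply: prodr_gt0 => i _; apply: b_gt0; exact: leq_trans (ltn_ord i) nN.
Qed.

(** At the first root [r] of [sturm_poly n.+1], the recurrence makes [sturm_poly n.+2] a negative
    multiple of [sturm_poly n], hence negative by the last conjunct. Being positive at 0, it has a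
    first root below [r]. *)
Lemma sturm_first_root n : (n < N)%N ->
  exists r, [/\ 0 < r, (sturm_poly n.+1).[r] = 0,
    forall x, 0 <= x -> x < r -> 0 < (sturm_poly n.+1).[x]
    & 0 < (sturm_poly n).[r]].
Proof.
elim: n => [|n IH] nN.
  exists (b 0 + d 1); have E x : (sturm_poly 1).[x] = b 0 + d 1 - x.
    by rewrite horner_sturm_poly d0 /= !hornerE; ring.
  split; rewrite ?E ?subrr // ?hornerE //.
    by rewrite addr_gt0 ?b_gt0 ?d_gt0.
  by move=> x _ xr; rewrite E subr_gt0.
have [r [r_gt0 Qr Qpos Q'r]] := IH (ltnW nN).
have neg : (sturm_poly n.+2).[r] < 0.
  rewrite horner_sturm_poly Qr mulr0 sub0r oppr_lt0.
  by rewrite !mulr_gt0 ?b_gt0 ?d_gt0 //= ltnW.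
have [s [/andP[s0 sr] Qs Qspos]] :=
  poly_first_root (ltW r_gt0) (sturm_poly_gt0 nN) neg.
by exists s; split => //; apply: Qpos => //; exact: ltW.
Qed.

Lemma sturm_poly_gradient l g n :
  gradient_eigenfunction l g -> (n <= N)%N ->
  (\prod_(i < n) b i.+1) * g n = (sturm_poly n).[l] * g 0.
Proof.
move=> gP; pose G k := (\prod_(i < k) b i.+1) * g k; rewrite -/(G n).
(* The recurrence has order two, so the induction carries two consecutive indices. *)
suff H : (n <= N)%N -> G n = (sturm_poly n).[l] * g 0 /\
                       G n.-1 = (sturm_poly n.-1).[l] * g 0.
  by case/H.
have G0 : G 0 = (sturm_poly 0).[l] * g 0 by rewrite /G big_ord0 /= hornerC.
elim: n => [//|n IH] nN; have [IH1 IH2] := IH (ltnW nN); split=> //.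
rewrite horner_sturm_poly mulrBl -!mulrA -IH1 -IH2.
rewrite {1}/G big_ord_recr /= -mulrA gP //.
case: n nN {IH IH1 IH2} => [|n] nN; first by rewrite d0 /G; ring.
by rewrite /G /= big_ord_recr /=; ring.
Qed.

Lemma gradient_neq0 l g :
  gradient_eigenfunction l g -> (exists2 n, (n < N)%N & g n != 0) -> g 0 != 0.
Proof.
move=> gP [n nN]; apply: contra_neq => g0.
have := sturm_poly_gradient gP (ltnW nN); rewrite g0 mulr0 => /eqP.
rewrite mulf_eq0 => /orP[|/eqP //]; rewrite gt_eqF //.
apply: prodr_gt0 => i _; apply: b_gt0.
exact: leq_ltn_trans (ltn_ord i) nN.
Qed.

(** At [n = N] the product in [sturm_poly_gradient] contains the factor [b N = 0], while [g 0] is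
    nonzero. *)
Lemma sturm_poly_root_of_gradient l g : (0 < N)%N ->
  gradient_eigenfunction l g -> (exists2 n, (n < N)%N & g n != 0) ->
  (sturm_poly N).[l] = 0.
Proof.
move=> N0 gP gn0; have g0 := gradient_neq0 gP gn0.
apply/eqP; rewrite -(mulIr_eq0 _ (mulIf g0)) -sturm_poly_gradient //.
case: N N0 bN => // m _ bm.
by rewrite big_ord_recr /= bm mulr0 mul0r.
Qed.

Lemma gradient_of_sturm_poly_root l : (0 < N)%N -> (sturm_poly N).[l] = 0 ->
  exists2 g, gradient_eigenfunction l g & g 0 = 1.
Proof.
move=> N0 QN.
exists (fun n => (sturm_poly n).[l] / \prod_(i < n) b i.+1); last first.
  by rewrite big_ord0 /= hornerE divr1.
have P0 n : (n < N)%N -> \prod_(i < n) b i.+1 != 0.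
  move=> nN; rewrite gt_eqF //; apply: prodr_gt0 => i _; apply: b_gt0.
  exact: leq_ltn_trans (ltn_ord i) nN.
move=> n nN.
(* For [n.+1 = N] the quotient on the left divides by 0; both sides still vanish, by [b N = 0] and
   by the root condition. *)
have -> : b n.+1 * ((sturm_poly n.+1).[l] / \prod_(i < n.+1) b i.+1)
        = (sturm_poly n.+1).[l] / \prod_(i < n) b i.+1.
  move: (nN); rewrite leq_eqVlt => /predU1P[eN|n1N].
    by rewrite eN bN QN !mul0r.
  have := P0 _ n1N; rewrite big_ord_recr /= mulf_eq0 negb_or => /andP[h1 h2].
  by rewrite invfM; field; rewrite h1 h2.
rewrite horner_sturm_poly; have h := P0 _ nN.
case: n nN h => [|n] nN h; first by rewrite d0; field.
move: h; rewrite /= big_ord_recr /= mulf_eq0 negb_or => /andP[h1 h2].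
by field; rewrite h1 h2.
Qed.

End BirthDeath.

(** With zero gradient, [f] would be constant on the states and killed by the generator, against
    [0 < l]. *)
Lemma eigenfunction_gradient_neq0 (R : realType) (b d : nat -> R) N l f :
  b N = 0 -> 0 < l -> bd_eigenfunction b d N l f ->
  (exists2 n, (n <= N)%N & f n != 0) ->
  exists2 n, (n < N)%N & f n.+1 - f n != 0.
Proof.
move=> bN l_gt0 fP [n nN fn].
have [/existsP[i gi]|/existsPn g0] :=
  boolP [exists i : 'I_N, f i.+1 - f i != 0]; first by exists i.
have f0 k : (k <= N)%N -> f k = f 0.
  elim: k => // k IH kN; have := g0 (Ordinal kN).
  by rewrite negbK subr_eq0 /= => /eqP ->; rewrite IH // ltnW.
have bf : b n * (f n.+1 - f n) = 0.
  move: nN; rewrite leq_eqVlt => /predU1P[->|nN]; first by rewrite bN mul0r.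
  by rewrite !f0 ?subrr ?mulr0 // ltnW.
have /eqP := fP n nN; rewrite bf !f0 ?(leq_trans (leq_pred n)) //.
rewrite subrr mulr0 add0r.
by rewrite eq_sym mulNr oppr_eq0 mulf_eq0 gt_eqF //= -(f0 n nN) (negPf fn).
Qed.

Lemma leigenvalueP (R : realType) (vT : vectType R) (L : 'End(vT)) (l : R) :
  passmx.leigenvalue L l <-> exists2 v, v != 0 & L v = l *: v.
Proof.
have kerE v : (v \in passmx.leigenspace L l) = (L v == l *: v).
  by rewrite memv_ker add_lfunE opp_lfunE scale_lfunE id_lfunE subr_eq0.
split=> [|[v v0 Lv]].
  rewrite /passmx.leigenvalue -vpick0 => v0.
  exists (vpick (passmx.leigenspace L l)) => //.
  by apply/eqP; rewrite -kerE memv_pick.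
rewrite /passmx.leigenvalue; apply: contraNneq v0 => L0.
by rewrite -memv0 -L0 kerE Lv.
Qed.

(** * The two-site process and its spectral gap *)

Section TwoSites.
Variables (R : realType) (a b p1 p2 : R).
Hypotheses (a_gt0 : 0 < a) (b_gt0 : 0 < b).
Hypotheses (p1_ge0 : 0 <= p1) (p2_ge0 : 0 <= p2).

Lemma birth_rate_full N : birth_rate b p2 N N = 0.
Proof. by rewrite /birth_rate subrr mul0r. Qed.

Lemma death_rate0 N : death_rate a p1 N 0 = 0.
Proof. by rewrite /death_rate mul0r. Qed.

Lemma birth_rate_gt0 N n : (1 < N)%N -> (n < N)%N -> 0 < birth_rate b p2 N n.
Proof.
move=> N1 nN; rewrite mulr_gt0 ?subr_gt0 ?ltr_nat // ltr_pwDl //.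
by rewrite mulr_ge0 // divr_ge0 // subr_ge0 ler1n ltnW.
Qed.

Lemma death_rate_gt0 N n :
  (1 < N)%N -> (0 < n <= N)%N -> 0 < death_rate a p1 N n.
Proof.
move=> N1 /andP[n0 nN]; rewrite mulr_gt0 ?ltr0n // ltr_pwDl //.
by rewrite mulr_ge0 // divr_ge0 // subr_ge0 ?ler1n ?ler_nat // ltnW.
Qed.

Lemma leigenvalue_generator N l :
  passmx.leigenvalue (- linfun (@generator R a b p1 p2 N)) l <->
  exists2 f, bd_eigenfunction (birth_rate b p2 N) (death_rate a p1 N) N l f
           & exists2 n, (n <= N)%N & f n != 0.
Proof.
apply: (iff_trans (leigenvalueP _ _)); split=> [[v v0 Lv]|[f fP [n nN fn]]].
  exists (fun n => v (inord n)) => [n nN|].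
    have := congr1 (fun u : state_fun R N => u (inord n)) Lv.
    rewrite !lfunE /= lfunE /= !ffunE inordK // => e.
    by rewrite mulNr -[l * _]e opprK.
  have /existsP[i vi] : [exists i, v i != 0].
    apply: contraNT v0 => /existsPn vE; apply/eqP/ffunP => i.
    by rewrite ffunE; apply/eqP; rewrite -[_ == _]negbK vE.
  by exists i; rewrite ?inord_val // -ltnS.
exists [ffun i : 'I_N.+1 => f i].
  apply: contra_neq fn => /ffunP/(_ (inord n)).
  by rewrite !ffunE inordK.
apply/ffunP => i; rewrite !lfunE /= lfunE /= !ffunE.
have iN : (i <= N)%N by rewrite -ltnS.
have := fP i iN; rewrite (inordK (m := i.-1)); last first.
  by apply: leq_ltn_trans (leq_pred _) _.
(* At [i = N] the values of [f] at [N.+1] and at [inord N.+1] may differ, but the birth rate there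
   is 0. *)
have -> : birth_rate b p2 N i * (f i.+1 - f i)
        = birth_rate b p2 N i * (f (inord i.+1 : 'I_N.+1) - f i).
  move: iN; rewrite leq_eqVlt => /predU1P[->|iN].
    by rewrite birth_rate_full !mul0r.
  by rewrite inordK.
by move=> ->; rewrite mulNr opprK.
Qed.

(** The gap is the first positive root [r] of [sturm_poly N]: this root produces an eigenfunction,
    and every positive eigenvalue is a root, hence at least [r]. *)
Lemma spectral_gap_gradient N : (1 < N)%N ->
  0 < spectral_gap a b p1 p2 N /\
  exists2 g, gradient_eigenfunction (birth_rate b p2 N) (death_rate a p1 N) N
               (spectral_gap a b p1 p2 N) g
           & g 0 = 1.
Proof.
move=> N1; have N0 := ltnW N1.
have bN := birth_rate_full N; have d0 := death_rate0 N.
have bpos n (nN : (n < N)%N) := birth_rate_gt0 N1 nN.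
have dpos n (nN : (0 < n <= N)%N) := death_rate_gt0 N1 nN.
have := @sturm_first_root _ _ _ N d0 bpos dpos N.-1.
rewrite prednK // => /(_ (leqnn N)) [r [r_gt0 Qr Qpos _]].
have [g gP g0] := gradient_of_sturm_poly_root d0 bN bpos N0 Qr.
suff -> : spectral_gap a b p1 p2 N = r by split => //; exists g.
apply: spectral_gap_eq; split => // [|l /leigenvalue_generator[f fP fn0] l_gt0].
  apply/leigenvalue_generator; eexists.
    exact: (eigenfunction_of_gradient d0 bN gP).
  by exists 0 => //=; rewrite d0 g0 mul0r mulr1 sub0r oppr_eq0 gt_eqF ?bpos.
rewrite leNgt; apply/negP => lr.
have := Qpos l (ltW l_gt0) lr.
rewrite (sturm_poly_root_of_gradient d0 bN bpos N0
  (gradient_of_eigenfunction d0 fP)) ?ltxx //.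
exact: eigenfunction_gradient_neq0 bN l_gt0 fP fn0.
Qed.

Lemma spectral_gap_ge N (c : R) (w : nat -> R) : (1 < N)%N ->
  (forall n, (n < N)%N -> 0 < w n) ->
  (forall n, (n < N)%N ->
     birth_rate b p2 N n.+1 * w n.+1 + death_rate a p1 N n * w n.-1 + c * w n
     <= (birth_rate b p2 N n + death_rate a p1 N n.+1) * w n) ->
  c <= spectral_gap a b p1 p2 N.
Proof.
move=> N1 w_gt0 wP; have [_ [g gP g0]] := spectral_gap_gradient N1.
apply: gradient_eigenvalue_ge gP _ w_gt0 wP => [||n nN|n nN|].
- exact: death_rate0.
- exact: birth_rate_full.
- exact: birth_rate_gt0.
- exact: death_rate_gt0.
- by exists 0; rewrite ?g0 ?oner_neq0 // ltnW.
Qed.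

End TwoSites.

(** * Uniform bounds from explicit weights *)

(* The condition on the weight w(n) = 1/m, where m = N - n, q = p1 / (N-1) and
   q' = p2 / (N-1). *)
Lemma weight_inequality (R : realFieldType) (a q q' n m : R) :
  0 <= n -> 0 < m -> 0 <= q' -> q' <= q -> q <= a / 2 ->
  q' + n * (a + q * m) / (m + 1) + a / 2 / m
  <= (n + 1) * (a + q * (m - 1)) / m.
Proof.
move=> n0 m0 q0 qq qa; rewrite -subr_ge0.
have -> : (n + 1) * (a + q * (m - 1)) / m
    - (q' + n * (a + q * m) / (m + 1) + a / 2 / m)
  = ((a / 2 - q) * (n + m + 1) + (q - q') * m * (m + 1) + a / 2 * n)
    / (m * (m + 1)).
  by field; rewrite !gt_eqF // addr_gt0.
by apply: divr_ge0; nra.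
Qed.

(** For this weight, birth rate times weight at [n < N] is [b + p2 * n / (N - 1)], so the two birth
    terms differ by at most [p2 / (N - 1)], whatever [b] is. *)
Lemma spectral_gap_ge_half_a (R : realType) (a b p1 p2 : R) N :
  0 < a -> 0 < b -> 0 <= p2 -> p2 <= p1 -> (1 < N)%N ->
  p1 <= a / 2 * (N%:R - 1) -> a / 2 <= spectral_gap a b p1 p2 N.
Proof.
move=> a0 b0 p20 p21 N1 pN; have p10 := le_trans p20 p21.
have NR : 0 < N%:R - 1 :> R by rewrite subr_gt0 ltr1n.
apply: (@spectral_gap_ge _ _ _ _ _ a0 b0 p10 p20 N _
  (fun n => (N%:R - n%:R)^-1)) => //.
  by move=> n nN; rewrite invr_gt0 subr_gt0 ltr_nat.
move=> n nN; rewrite /birth_rate /death_rate.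
set K : R := N%:R - 1 in NR pN *.
have m0 : 0 < N%:R - n%:R :> R by rewrite subr_gt0 ltr_nat.
have -> : N%:R - n.+1%:R = N%:R - n%:R - 1 :> R by rewrite -natr1; ring.
rewrite -natr1.
(* The truncation of [n.-1] at [n = 0] is harmless, as the factor [n] makes both sides 0. *)
have dE : n%:R * (a + p1 * ((N%:R - n%:R) / K)) / (N%:R - n.-1%:R)
        = n%:R * (a + p1 / K * (N%:R - n%:R)) / (N%:R - n%:R + 1).
  case: n nN {m0} => [|n] nN; first by rewrite !mul0r.
  rewrite -[n.+1.-1]/n -natr1; congr (_ * (_ + _) / _); ring.
set m : R := N%:R - n%:R in m0 dE *.
have := @weight_inequality _ a (p1 / K) (p2 / K) n%:R m (ler0n _ _) m0.
rewrite !ler_pM2r ?invr_gt0 // ler_pdivrMr // divr_ge0 ?(ltW NR) //.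
move=> /(_ isT p21 pN) key; rewrite dE.
(* An equality except at [n = N - 1], where the weight at [N] is the inverse of 0, that is 0, and
   the left-hand side vanishes. *)
have bE : (m - 1) * (b + p2 * ((n%:R + 1) / K)) / (m - 1)
    <= b + p2 * ((n%:R + 1) / K).
  have [->|m1] := eqVneq (m - 1) 0; last by rewrite mulrAC divff // mul1r.
  rewrite !mul0r addr_ge0 ?(ltW b0) // mulr_ge0 //.
  by rewrite divr_ge0 ?(ltW NR) ?addr_ge0.
apply: le_trans (lerD (lerD bE (lexx _)) (lexx _)) _.
rewrite [leRHS](_ : _ = b + p2 * (n%:R / K)
    + (n%:R + 1) * (a + p1 / K * (m - 1)) / m); last first.
  by field; rewrite !gt_eqF.
apply: le_trans (lerD (lexx (b + p2 * (n%:R / K))) key).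
by rewrite le_eqVlt; apply/orP; left; apply/eqP; field;
   rewrite !gt_eqF // addr_gt0.
Qed.

(** The reflection of the states sends the edge [n] to [N - 1 - n], so the weight becomes
    [1 / (n + 1)]. *)
Lemma spectral_gap_ge_half_b (R : realType) (a b p1 p2 : R) N :
  0 < a -> 0 < b -> 0 <= p1 -> p1 <= p2 -> (1 < N)%N ->
  p2 <= b / 2 * (N%:R - 1) -> b / 2 <= spectral_gap a b p1 p2 N.
Proof.
move=> a0 b0 p10 p12 N1 pN; have p20 := le_trans p10 p12.
have NR : 0 < N%:R - 1 :> R by rewrite subr_gt0 ltr1n.
apply: (@spectral_gap_ge _ _ _ _ _ a0 b0 p10 p20 N _
  (fun n => n.+1%:R^-1)) => //.
  by move=> n nN; rewrite invr_gt0 ltr0n.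
move=> n nN; rewrite /birth_rate /death_rate.
set K : R := N%:R - 1 in NR pN *.
have m0 : 0 <= N%:R - n.+1%:R :> R by rewrite subr_ge0 ler_nat.
have mE : N%:R - n%:R = N%:R - n.+1%:R + 1 :> R by rewrite -natr1; ring.
have n0 : 0 < n.+1%:R :> R by rewrite ltr0n.
(* An equality except at [n = 0], where the left-hand side is 0. *)
have dE : n%:R * (a + p1 * ((N%:R - n%:R) / K)) / n.-1.+1%:R
        <= a + p1 * ((N%:R - n%:R) / K).
  case: n {nN m0 n0} mE m0 => [|n] mE m0.
    rewrite !mul0r mE addr_ge0 ?(ltW a0) // mulr_ge0 // divr_ge0 ?(ltW NR) //.
    exact: addr_ge0 m0 ler01.
  by rewrite mulrAC divff ?mul1r // pnatr_eq0.
apply: le_trans (lerD (lerD (lexx _) dE) (lexx _)) _.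
have nE : n%:R = n.+1%:R - 1 :> R by rewrite -natr1; ring.
rewrite -(@natr1 _ n.+1) mE nE {dE mE nE}.
set m : R := N%:R - _ in m0 *; set k : R := n.+1%:R in n0 *; clearbody k.
(* After reflection, [m = N - (n + 1)] stands for the state and [k = n + 1] for its distance to
   [N]. *)
have := @weight_inequality _ b (p2 / K) (p1 / K) m k m0 n0.
rewrite !ler_pM2r ?invr_gt0 // ler_pdivrMr // divr_ge0 ?(ltW NR) //.
move=> /(_ isT p12 pN) key.
rewrite [leRHS](_ : _ = a + p1 * (m / K)
    + (m + 1) * (b + p2 / K * (k - 1)) / k); last first.
  by field; rewrite !gt_eqF.
apply: le_trans (lerD (lexx (a + p1 * (m / K))) key).
by rewrite le_eqVlt; apply/orP; left; apply/eqP; field;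
   rewrite !gt_eqF // addr_gt0.
Qed.

(** The threshold [n1] is lowered one step at a time, replacing [c] by its minimum with the value at
    the new index; the final halving makes the bound strict. *)
Lemma lower_bound_of_eventual (R : realFieldType) (u : nat -> R) (c : R) n0 n1 :
  0 < c -> (forall n, (n0 <= n)%N -> 0 < u n) ->
  (forall n, (n0 <= n)%N -> (n1 <= n)%N -> c <= u n) ->
  exists2 c', 0 < c' & forall n, (n0 <= n)%N -> c' < u n.
Proof.
move=> + u0; elim: n1 c => [|k IH] c c0 cu.
  exists (c / 2) => [|n nn]; first by rewrite divr_gt0.
  by apply: lt_le_trans (cu n nn _) => //; lra.
have [kn0|n0k] := ltnP k n0.
  by apply: (IH c) => // n nn _; apply: cu => //; exact: leq_trans kn0 nn.
apply: (IH (Num.min c (u k))) => [|n nn]; first by rewrite lt_min c0 u0.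
rewrite leq_eqVlt => /predU1P[<-|kn]; first by rewrite ge_min lexx orbT.
by rewrite ge_min cu.
Qed.

Theorem theorem4p4 (R : realType) (a b p1 p2 : R)
    (ha : 0 < a) (hb : 0 < b) (hp1 : 0 <= p1) (hp2 : 0 <= p2)
    (hp : 0 < p1 + p2) :
  let rho := a + b - (Num.max p1 p2 - Num.min p1 p2) in
  rho <= 0 ->
  exists2 c : R, 0 < c &
    forall N : nat, (2 <= N)%N -> c < spectral_gap a b p1 p2 N.
Proof.
move=> _ _.
have large (x y : R) : 0 < x -> 0 <= y ->
    exists n1, forall N, (n1 <= N)%N -> y <= x / 2 * (N%:R - 1).
  (* The inequality amounts to [N - 1 >= 2 * y / x], so an Archimedean bound of the right-hand side,
     plus 1, suffices. *)
  move=> x0 y0; exists (Num.bound (y * 2 / x)).+1 => N nN.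
  have h : 0 <= y * 2 / x by rewrite divr_ge0 ?mulr_ge0 // ltW.
  have := archi_boundP h; rewrite ltr_pdivrMr // => e.
  have : (Num.bound (y * 2 / x)).+1%:R <= N%:R :> R by rewrite ler_nat.
  rewrite -natr1; nra.
have gap_gt0 N (N1 : (2 <= N)%N) := (spectral_gap_gradient ha hb hp1 hp2 N1).1.
have [p21|/ltW p12] := lerP p2 p1.
  have [n1 n1P] := large a p1 ha hp1.
  apply: (@lower_bound_of_eventual _ _ (a / 2) 2 n1) => // [|N N2 /n1P pN].
    by rewrite divr_gt0.
  exact: spectral_gap_ge_half_a.
have [n1 n1P] := large b p2 hb hp2.
apply: (@lower_bound_of_eventual _ _ (b / 2) 2 n1) => // [|N N2 /n1P pN].
  by rewrite divr_gt0.
exact: spectral_gap_ge_half_b.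
Qed.
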